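(* For every integer $k\ge 1$, there exists an infinite family of pairwise non-isomorphic $k$-connected graphs such that each graph in the family has a pair of longest paths $P$ and $Q$ with $|V(P)\cap V(Q)|=k$.
   Context: All graphs are finite and simple (no loops, no parallel edges). Paths are simple (no repeated vertices or edges). The length of a path is its number of edges, and a longest path in a graph is a path of maximum length among all paths in the graph. Two paths with the same two extremes are internally disjoint if they have no internal vertices in common. A graph $G$ (with at least two vertices) is $k$-connected if, for any two distinct vertices $u$ and $v$ of $G$, there exists a set of $k$ distinct pairwise internally disjoint $u$-$v$ paths. *)

(* Defs.v *)
From mathcomp Require Import all_boot.

Set Implicit Arguments.
Unset Strict Implicit.
Unset Printing Implicit Defensive.

Record sgraph := SGraph {
  vertex :> finType;
  adj : rel vertex;
  adj_sym : symmetric adj;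
  adj_irrefl : irreflexive adj }.

Definition isomorphic (G H : sgraph) : Prop :=
  exists f : G -> H, bijective f /\ forall x y, adj (f x) (f y) = adj x y.

Section Paths.
Variable G : sgraph.

(* A path is the nonempty sequence of its vertices, in order; a sequence and  *)
(* its reversal therefore describe the same path.                             *)
Definition is_path (P : seq G) : bool :=
  [&& P != [::], sorted (@adj G) P & uniq P].

Definition path_length (P : seq G) : nat := (size P).-1.

Definition path_vertices (P : seq G) : {set G} := [set x in P].

Definition longest_path (P : seq G) : Prop :=
  is_path P /\ forall Q, is_path Q -> path_length Q <= path_length P.

(* The default values of [head] and [last] are irrelevant, as P is nonempty.  *)
(* For u != v, fixing the direction from u to v makes the sequence unique, so *)
(* distinct sequences are distinct u-v paths.                                 *)
Definition is_uv_path (u v : G) (P : seq G) : bool :=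
  [&& is_path P, head u P == u & last v P == v].

Definition internal_vertices (u v : G) (P : seq G) : {set G} :=
  path_vertices P :\: [set u; v].

Definition internally_disjoint (u v : G) (P Q : seq G) : bool :=
  [disjoint internal_vertices u v P & internal_vertices u v Q].

End Paths.

Definition k_connected (k : nat) (G : sgraph) : Prop :=
  1 < #|G| /\
  forall u v : G, u != v ->
    exists Ps : seq (seq G),
      [/\ size Ps = k, uniq Ps, all (is_uv_path u v) Ps
        & {in Ps &, forall P Q, P != Q -> internally_disjoint u v P Q}].

(* Main.v *)
Require Import Defs.
From mathcomp Require Import all_boot.
From mathcomp Require Import perm zify.

(** The complete bipartite graphs K_(k,n) with n >= 2k+2 form the required
family. They have different numbers of vertices, and K_(k,n) is k-connected as
soon as 1 <= k <= n (lemma [biclique_connected]).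

A path alternates between the two sides, so it has at most one more vertex on
the large side than on the small one; it therefore has at most 2k+1 vertices
(lemma [size_biclique_path]). Conversely, for any k+1 vertices of the large
side, some path visits exactly these vertices and the whole small side (lemma
[longest_path_through]), and it is a longest path. Two disjoint sets of k+1
vertices on the large side yield two longest paths which meet exactly in the
small side, that is, in k vertices. *)

Set Implicit Arguments.
Unset Strict Implicit.
Unset Printing Implicit Defensive.

Lemma isomorphic_card (G H : sgraph) : isomorphic G H -> #|G| = #|H|.
Proof. by case=> f [f_bij _]; apply: bij_eq_card f_bij. Qed.

Section Biclique.
Variables A B : finType.

Definition is_left (x : A + B) : bool := if x is inl _ then true else false.

Definition biclique_adj : rel (A + B) := fun x y => is_left x != is_left y.

Lemma biclique_adj_sym : symmetric biclique_adj.
Proof. by move=> x y; rewrite /biclique_adj eq_sym. Qed.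

Lemma biclique_adj_irrefl : irreflexive biclique_adj.
Proof. by move=> x; rewrite /biclique_adj eqxx. Qed.

(** The complete bipartite graph with sides [A] and [B]. *)
Definition biclique : sgraph := SGraph biclique_adj_sym biclique_adj_irrefl.

(** Identifying [A] with its image under an injection [f] into [B], the
vertices [inl x] and [inr (f x)] are those attached to [x]. *)
Definition attached (f : A -> B) (x : A) (z : biclique) : bool :=
  match z with inl a => a == x | inr b => b == f x end.

(** Paths indexed by [A] are internally disjoint if the internal vertices of
the path of index [x] are attached to [x]. *)
Lemma disjoint_uv_paths (f : A -> B) (u v : biclique) (F : A -> seq biclique) :
    injective f -> injective F -> (forall x, is_uv_path u v (F x)) ->
    (forall x z, z \in F x -> [|| z == u, z == v | attached f x z]) ->
  exists Ps : seq (seq biclique),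
    [/\ size Ps = #|A|, uniq Ps, all (is_uv_path u v) Ps
      & {in Ps &, forall P Q, P != Q -> internally_disjoint u v P Q}].
Proof.
move=> f_inj F_inj F_path F_att; exists [seq F x | x <- enum A]; split.
- by rewrite size_map -cardE.
- by rewrite map_inj_uniq ?enum_uniq.
- by apply/allP => _ /mapP[x _ ->].
- move=> _ _ /mapP[x _ ->] /mapP[y _ ->] neqF.
  apply/pred0P => z; apply/negP; rewrite /= !inE.
  case/andP=> /andP[nuv /F_att zx] /andP[_ /F_att zy].
  move: zx zy; rewrite !orbA (negPf nuv) /=.
  move=> zx zy; case/eqP: neqF; congr (F _).
  case: z {nuv} zx zy => z /= /eqP-> /eqP //.
  exact: f_inj.
Qed.

(** The [#|A|] paths are indexed by the vertices of [A]. Two vertices on the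
same side are joined by paths of length two through their common neighbours.
Between [inl a] and [inr b], an injection [g] with [g a = b] turns each other
[x] into a path of length three through [inr (g x)] and [inl x], and [a] itself
gives the edge. *)
Lemma biclique_connected : 0 < #|A| <= #|B| -> k_connected #|A| biclique.
Proof.
move=> /andP[A_gt0 leAB]; split; first by rewrite card_sum; lia.
have [f f_inj] : exists f : A -> B, injective f.
  exists (fun x => enum_val (widen_ord leAB (enum_rank x))) => x y.
  by move/enum_val_inj/(congr1 val) => /= /val_inj/enum_rank_inj.
have matching a b : exists2 g : A -> B, injective g & g a = b.
  exists (fun x => tperm (f a) b (f x)); last by rewrite tpermL.
  by move=> x y /perm_inj/f_inj.
case=> [a|b] [a'|b'] uv.
- apply: (@disjoint_uv_paths f _ _ (fun x => [:: inl a; inr (f x); inl a'])).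
  + exact: f_inj.
  + by move=> x y [/f_inj].
  + by move=> x; rewrite /is_uv_path /is_path /= !inE !eqxx !andbT (negPf uv).
  + by move=> x z; rewrite !inE => /or3P[] /eqP->; rewrite /= !eqxx ?orbT.
- have [g g_inj <-] := matching a b'.
  apply: (@disjoint_uv_paths g _ _ (fun x => if x == a
    then [:: inl a; inr (g a)] else [:: inl a; inr (g x); inl x; inr (g a)])).
  + exact: g_inj.
  + by move=> x y; case: eqP => [->|_]; case: eqP => [->|_] // [].
  + move=> x; rewrite /is_uv_path; case: eqVneq => [|neq] /=.
      by rewrite !eqxx.
    rewrite /is_path /= !inE /= !eqxx !andbT.
    rewrite !orbF; apply/andP; split.
      by apply: contra neq => /eqP[->].
    by apply: contra neq => /eqP[/g_inj ->].
  + move=> x z; case: eqVneq => _; rewrite !inE.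
      by case/orP=> ->; rewrite ?orbT.
    by case/or4P=> /eqP->; rewrite /= !eqxx ?orbT.
- have [g g_inj <-] := matching a' b.
  apply: (@disjoint_uv_paths g _ _ (fun x => if x == a'
    then [:: inr (g a'); inl a']
    else [:: inr (g a'); inl x; inr (g x); inl a'])).
  + exact: g_inj.
  + by move=> x y; case: eqP => [->|_]; case: eqP => [->|_] // [].
  + move=> x; rewrite /is_uv_path; case: eqVneq => [|neq] /=.
      by rewrite !eqxx.
    rewrite /is_path /= !inE /= !eqxx !andbT.
    rewrite !orbF; apply/andP; split.
      by apply: contra neq => /eqP[/g_inj ->].
    by apply: contra neq => /eqP[->].
  + move=> x z; case: eqVneq => _; rewrite !inE.
      by case/orP=> ->; rewrite ?orbT.
    by case/or4P=> /eqP->; rewrite /= !eqxx ?orbT.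
- apply: (@disjoint_uv_paths f _ _ (fun x => [:: inr b; inl x; inr b'])).
  + exact: f_inj.
  + by move=> x y [].
  + by move=> x; rewrite /is_uv_path /is_path /= !inE !eqxx !andbT (negPf uv).
  + by move=> x z; rewrite !inE => /or3P[] /eqP->; rewrite /= !eqxx ?orbT.
Qed.

(** Left and right vertices alternate along a path: each right vertex of [p] is
preceded in [x :: p] by a left vertex of its own. *)
Lemma count_path_biclique (x : biclique) (p : seq biclique) :
  path (@adj biclique) x p ->
  count (predC is_left) p <= count is_left p + is_left x.
Proof.
elim: p x => [|y p IHp] x //= /andP[xy /IHp].
by move: xy; rewrite /biclique_adj; case: x y => ? [] ?; rewrite //=; lia.
Qed.

Lemma size_biclique_path (P : seq biclique) :
  is_path P -> size P <= #|A|.*2.+1.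
Proof.
case/and3P; case: P => [|x p] // _ /= /count_path_biclique le_count uniqP.
have le_left : count is_left (x :: p) <= #|A|.
  rewrite -size_filter cardE -(size_map (@inl A B)).
  apply: uniq_leq_size; first exact: filter_uniq.
  by case=> z; rewrite mem_filter // map_f ?mem_enum.
have := count_predC is_left (x :: p).
move: le_left le_count => /=. case: x {uniqP} => ? /=; lia.
Qed.

(** The alternating path through the vertices of [t] and [s], from the head of
[t] to its last vertex if [t] is one longer than [s]. *)
Fixpoint zigzag (t : seq B) (s : seq A) : seq biclique :=
  match t, s with
  | b :: t', a :: s' => [:: inr b, inl a & zigzag t' s']
  | b :: _, [::] => [:: inr b]
  | [::], _ => [::]
  end.

Lemma zigzag_path b t s (a : A) :
  path (@adj biclique) (inl a) (zigzag (b :: t) s).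
Proof. by elim: s b t a => [|a' s IHs] b [|b' t] a //=; apply: IHs. Qed.

Lemma perm_zigzag t s : size t = (size s).+1 ->
  perm_eq (zigzag t s) (map inl s ++ map inr t).
Proof.
elim: s t => [|a s IHs] [|b t] //=.
  by case: t.
case=> /IHs Ht.
rewrite perm_sym -cat_cons perm_catC /= perm_cons perm_catC /= perm_cons.
by rewrite perm_sym.
Qed.

Lemma longest_path_through (t : seq B) : uniq t -> size t = #|A|.+1 ->
  exists2 P : seq biclique, longest_path P
    & path_vertices P =
      [set z | match z with inl _ => true | inr b => b \in t end].
Proof.
move=> t_uniq size_t.
have permP : perm_eq (zigzag t (enum A)) (map inl (enum A) ++ map inr t).
  by apply: perm_zigzag; rewrite size_t cardE.
have memP z : (z \in zigzag t (enum A)) =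
    match z with inl _ => true | inr b => b \in t end.
  rewrite (perm_mem permP) mem_cat; case: z => z.
    by rewrite map_f ?mem_enum.
  rewrite (mem_map (@inr_inj A B)) orbC; case: (z \in t) => //=.
  by apply/negP => /mapP[].
exists (zigzag t (enum A)); last by apply/setP => z; rewrite !inE memP.
have sizeP : size (zigzag t (enum A)) = #|A|.*2.+1.
  rewrite (perm_size permP) size_cat (size_map inl) (size_map inr) size_t -cardE.
  by rewrite addnS addnn.
split; last first.
  by move=> Q /size_biclique_path; rewrite /path_length sizeP; lia.
apply/and3P; split.
- by rewrite -size_eq0 sizeP.
- case: (t) (enum A) => [|b [|b' t']] [|a s] //=.
  exact: zigzag_path.
- rewrite (perm_uniq permP) cat_uniq (map_inj_uniq (@inl_inj A B)).
  rewrite (map_inj_uniq (@inr_inj A B)) enum_uniq t_uniq andbT /=.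
  by apply/hasPn => _ /mapP[b _ ->]; apply/negP => /mapP[].
Qed.

End Biclique.

Theorem theorem5p1 (k : nat) (hk : 1 <= k) :
  exists G : nat -> sgraph,
    (forall i j : nat, i <> j -> ~ isomorphic (G i) (G j)) /\
    (forall i : nat,
       k_connected k (G i) /\
       exists P Q : seq (G i),
         [/\ longest_path P, longest_path Q
           & #|path_vertices P :&: path_vertices Q| = k]).
Proof.
exists (fun i => biclique 'I_k 'I_(i + (k.+1 + k.+1))); split=> [i j neq|i].
  by move/isomorphic_card; rewrite !card_sum !card_ord; lia.
split.
  have := @biclique_connected 'I_k 'I_(i + (k.+1 + k.+1)).
  by rewrite !card_ord; apply; lia.
(* Two disjoint sets of k+1 vertices on the large side. *)
pose t1 := [seq rshift i (lshift k.+1 x) | x <- enum 'I_k.+1].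
pose t2 := [seq rshift i (rshift k.+1 x) | x <- enum 'I_k.+1].
have [||P longP vertP] := @longest_path_through 'I_k _ t1.
- rewrite map_inj_uniq ?enum_uniq // => x y.
  by move/rshift_inj/lshift_inj.
- by rewrite size_map size_enum_ord card_ord.
have [||Q longQ vertQ] := @longest_path_through 'I_k _ t2.
- rewrite map_inj_uniq ?enum_uniq // => x y.
  by move/rshift_inj/rshift_inj.
- by rewrite size_map size_enum_ord card_ord.
exists P, Q; split=> //; rewrite vertP vertQ.
transitivity #|[set (inl x : 'I_k + 'I_(i + (k.+1 + k.+1))) | x : 'I_k]|.
  apply: eq_card => -[x|y]; rewrite !inE.
    by rewrite imset_f.
  transitivity false; last by apply/esym/negP => /imsetP[].
  apply/negP => /andP[/mapP[x _ ->] /mapP[z _ /rshift_inj/eqP]].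
  by rewrite eq_lrshift.
by rewrite card_imset ?card_ord //; apply: inl_inj.
Qed.
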